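(* The Finsleroid Indicatrix $\{R\in V_N: K(g;R)=1\}$ is a closed (compact, without boundary), regular hypersurface of $V_N$, and it is strongly convex, i.e. it bounds a convex body and its second fundamental form (with respect to the inward normal and the Euclidean structure of $V_N$) is positive definite at every point.
   Context: Let $N\ge2$, $V_N=\mathbb{R}^N$ with points $R=(R^1,\dots,R^N)$, $Z=R^N$; indices $a,b$ run over $1,\dots,N-1$, repeated indices summed. Fix a symmetric positive-definite matrix $(r_{ab})$, $q(R)=\sqrt{r_{ab}R^aR^b}$. Fix $g\in(-2,2)$, $h=\sqrt{1-g^2/4}$, $G=g/h$. Define $B(g;R)=Z^2+gqZ+q^2$, $A(g;R)=Z+\frac12gq$, $\Phi(g;R)=\arctan(A/(hq))$ for $q>0$ ($\Phi=\pm\pi/2$ if $q=0$, $Z\gtrless0$), $J=e^{\frac12G\Phi}$, and the Finsleroid metric function $K(g;R)=\sqrt{B}\,J$ ($K(g;0)=0$). *)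

(* Defs.v *)
From HB Require Import structures.
From mathcomp Require Import all_boot all_order all_algebra.
From mathcomp Require Import all_classical all_reals all_analysis.
Set Implicit Arguments. Unset Strict Implicit. Unset Printing Implicit Defensive.
Import Order.TTheory GRing.Theory Num.Theory.
Import numFieldNormedType.Exports.
Local Open Scope classical_set_scope.
Local Open Scope ring_scope.

Section Finsleroid.
Variables (R : realType) (n : nat).

(* Coordinates: R^1..R^(N-1) are the entries 0..n-1, Z = R^N is entry n. *)
Definition Zc (x : 'rV[R]_n.+1) : R := x 0 ord_max.
Definition xa (x : 'rV[R]_n.+1) : 'rV[R]_n :=
  \row_(a < n) x 0 (widen_ord (leqnSn n) a).

Variables (r : 'M[R]_n) (g : R).

Definition qf (x : 'rV[R]_n.+1) : R := Num.sqrt ((xa x *m r *m (xa x)^T) 0 0).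
Definition hg : R := Num.sqrt (1 - g ^+ 2 / 4).
Definition Gg : R := g / hg.
Definition Bf (x : 'rV[R]_n.+1) : R := Zc x ^+ 2 + g * qf x * Zc x + qf x ^+ 2.
Definition Af (x : 'rV[R]_n.+1) : R := Zc x + g / 2 * qf x.
Definition Phif (x : 'rV[R]_n.+1) : R :=
  if 0 < qf x then atan (Af x / (hg * qf x))
  else if 0 < Zc x then pi / 2 else if Zc x < 0 then - (pi / 2) else 0.
Definition Jf (x : 'rV[R]_n.+1) : R := expR (Gg / 2 * Phif x).
Definition Kf (x : 'rV[R]_n.+1) : R :=
  if x == 0 then 0 else Num.sqrt (Bf x) * Jf x.

End Finsleroid.

Section Geometry.
Variables (R : realType) (N : nat).
Local Notation V := 'rV[R]_N.

Definition edot (u v : V) : R := (u *m v^T) 0 0.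
Definition enorm (u : V) : R := Num.sqrt (edot u u).

Definition grad (F : V -> R) (x : V) : V := \row_i 'D_(delta_mx 0 i) F x.

Definition C2_near (F : V -> R) (x : V) : Prop :=
  \forall y \near x,
    [/\ differentiable F y,
        (forall v : V, differentiable ('D_v F) y) &
        (forall u v : V, {for y, continuous ('D_u ('D_v F))})].

(* Second fundamental form at x of the level hypersurface {F = F x}, with
   respect to the unit normal -grad F/|grad F| (pointing into {F < F x}) and
   the Euclidean structure: II(u,v) = Hess F(u,v) / |grad F(x)| for tangent
   vectors u, v (i.e. edot u (grad F x) = 0). *)
Definition sff (F : V -> R) (x u v : V) : R :=
  'D_u ('D_v F) x / enorm (grad F x).

Definition tangent (F : V -> R) (x u : V) : Prop := edot u (grad F x) = 0.

Definition convex (C : set V) : Prop :=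
  forall x y (t : R), 0 <= t <= 1 -> C x -> C y -> C (t *: x + (1 - t) *: y).

End Geometry.

(* Main.v *)
Require Import Defs.
From HB Require Import structures.
From mathcomp Require Import all_boot all_order all_algebra.
From mathcomp Require Import all_classical all_reals all_analysis.
From mathcomp Require Import ring lra.
Import Order.TTheory GRing.Theory Num.Theory.
Import numFieldNormedType.Exports.
Local Open Scope classical_set_scope.
Local Open Scope ring_scope.

(** Everything follows from the support inequality [dK x y <= K y] (x <> 0),
    where [dK x y = K x * mf x y / B x] and
    [mf x y = <x, y>_r + (Z x + g q x) Z y]. In the polar coordinates
    A = sqrt B sin Phi, h q = sqrt B cos Phi it reduces, by Cauchy-Schwarz, to
    cos d + c sin d <= e^(c d) for |d| <= pi and c = G / 2, which holds because
    e^(-c t) (cos t + c sin t) has derivative - (1 + c^2) e^(-c t) sin t.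

    The inequality exhibits K as a supremum of linear forms, hence convex. It
    also makes x |-> dK x a continuous field of subgradients, hence the
    differential of K, also on the axis q = 0, where q is not differentiable.
    Differentiating once more, a tangent vector u (one with mf x u = 0) gets
    Hess K (u, u) = K (<u, u>_r + (Z u)^2 + g s Z u) / B with
    s = <x, u>_r / q and s^2 <= <u, u>_r, which is positive since |g| < 2. *)

(** * Differentials from first-order estimates *)

Section DifferentiationLemmas.
Set Implicit Arguments.
Unset Strict Implicit.

(** Unfolding the little-o lets differentials be established by inequalities; continuity of [l] is
    what [diff_unique] needs to recognise it as the differential. *)
Lemma is_diffP (R : realType) (V : normedModType R) (f : V -> R) (x : V)
    (l : {linear V -> R}) : continuous l ->
  is_diff x f l <->
  forall e : R, 0 < e ->
    \forall y \near x, `|f y - f x - l (y - x)| <= e * `|y - x|.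
Proof.
move=> lc.
have aux : f \o shift x = cst (f x) + l +o_ 0 id <->
   forall e : R, 0 < e ->
     \forall y \near x, `|f y - f x - l (y - x)| <= e * `|y - x|.
  split=> [/eqaddoP H e e0|H].
    rewrite (near_shift 0 x); apply: filterS (H e e0) => y.
    by rewrite /= !fctE /cst /= subr0 addrK opprD addrA.
  apply/eqaddoP => e e0.
  move: (H e e0); rewrite (near_shift 0 x) /=; apply: filterS => y.
  by rewrite /= !fctE /cst /= subr0 addrK opprD addrA.
split=> [[df dfl]|/aux H].
  by apply/aux; move/diff_locallyP: df => [_]; rewrite dfl.
have dfl := diff_unique lc H.
by split=> //; apply/diff_locallyP; rewrite dfl.
Qed.

Lemma near_eq_is_diff (R : realType) (V : normedModType R)
    (f h df : V -> R) (x : V) :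
  (\forall y \near x, f y = h y) -> is_diff x f df -> is_diff x h df.
Proof.
move=> fh [dfx <-]; have lc := diff_continuous dfx.
have /(is_diffP _ _ lc) H : is_diff x f ('d f x) by split.
apply/(is_diffP _ _ lc) => e e0; have fhx := nbhs_singleton fh.
by near=> y; rewrite -fhx -(near fh y) //; near: y; exact: H.
Unshelve. all: by end_near. Qed.

(** The increment splits into [c y] times the first-order error of [f] plus [c y - c x] times a
    Lipschitz term, so continuity of [c] suffices. This serves on the axis q = 0, with [c] equal to
    [1 / B]. *)
Lemma is_diff_vanishM (R : realType) (V : normedModType R) (c f df : V -> R)
    (x : V) :
  {for x, continuous c} -> is_diff x f df -> f x = 0 ->
  is_diff x (c * f) (c x *: df).
Proof.
move=> cc [dfx <-] fx0; have lc := diff_continuous dfx.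
have /(is_diffP _ _ lc) H : is_diff x f ('d f x) by split.
have lc' : continuous (c x \*: 'd f x).
  move=> y; apply: (continuous_comp (g := *:%R (c x)) (lc y)).
  exact: scaler_continuous.
have [k k0 lk] := linear_lipschitz lc.
suff : is_diff x (c * f) (c x \*: 'd f x) by [].
apply/(is_diffP _ _ lc') => e e0.
(* [M] bounds [|c y|] once [c y] is within 1 of [c x], hence the 1 in the minimum below; each of the
   two terms receives half of [e]. *)
pose M := `|c x| + 1.
have M0 : 0 < M by rewrite ltr_wpDl.
have e1 : 0 < e / (2 * M) by rewrite divr_gt0 // mulr_gt0.
have e2 : 0 < e / (2 * k) by rewrite divr_gt0 // mulr_gt0.
have m0 : 0 < Num.min 1 (e / (2 * k)) by rewrite lt_min ltr01.
have cm : \forall y \near x, `|c x - c y| <= Num.min 1 (e / (2 * k)).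
  by move/cvgrPdist_le: cc; exact.
near=> y.
rewrite !fctE /= fx0 mulr0 subr0.
have -> : c y * f y - c x *: 'd f x (y - x) =
   c y * (f y - 'd f x (y - x)) + (c y - c x) * 'd f x (y - x).
  by rewrite /GRing.scale /=; ring.
rewrite (le_trans (ler_normD _ _)) // !normrM.
have -> : e * `|y - x| =
    M * (e / (2 * M) * `|y - x|) + e / (2 * k) * (k * `|y - x|).
  by field; rewrite !gt_eqF.
have cxy : `|c x - c y| <= Num.min 1 (e / (2 * k)).
  by near: y; exact: cm.
move: cxy; rewrite distrC le_min => /andP[c1 c2].
apply: lerD; apply: ler_pM => //.
  rewrite -(subrK (c x) (c y)) (le_trans (ler_normD _ _)) // addrC lerD2l //.
have : `|f y - f x - 'd f x (y - x)| <= e / (2 * M) * `|y - x|.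
  by near: y; exact: H.
by rewrite fx0 subr0.
Unshelve. all: by end_near. Qed.

Lemma is_diff_derive (R : realType) (V : normedModType R) (f df : V -> R)
    (x : V) : is_diff x f df -> forall v, 'D_v f x = df v.
Proof. by move=> [dfx dfE] v; rewrite deriveE // dfE. Qed.

Lemma is_diff_inv (R : realType) (V : normedModType R) (f df : V -> R) (x : V) :
  is_diff x f df -> f x != 0 ->
  is_diff x (fun y => (f y)^-1) (- (f x) ^- 2 *: df).
Proof.
by move=> [dfx <-] fx0; split; [exact: differentiableV | rewrite diffV].
Qed.

(** * Continuity at a point: sums, norms, squeezing *)

Section Continuity.
Variables (R : realType) (T : topologicalType).
Implicit Types (f lo hi : T -> R) (x : T).

Lemma continuous_sum (I : finType) (F : I -> T -> R) x :
  (forall i, {for x, continuous (F i)}) ->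
  {for x, continuous (fun y => \sum_i F i y)}.
Proof.
move=> Fc; apply: cvg_big => [|i _]; last exact: Fc.
exact: add_continuous.
Qed.

Lemma continuous_norm f x :
  {for x, continuous f} -> {for x, continuous (fun y => `|f y|)}.
Proof. exact: cvg_norm. Qed.

Lemma continuous_near_lt f x a :
  {for x, continuous f} -> f x < a -> \forall y \near x, f y < a.
Proof. by move=> /cvgr_lt; apply. Qed.

Lemma continuous_near_gt f x a :
  {for x, continuous f} -> a < f x -> \forall y \near x, a < f y.
Proof. by move=> /cvgr_gt; apply. Qed.

Lemma continuous_squeeze f lo hi x :
  {for x, continuous lo} -> {for x, continuous hi} ->
  lo x = f x -> hi x = f x -> (\forall y \near x, lo y <= f y <= hi y) ->
  {for x, continuous f}.
Proof.
move=> loc hic lox hix H; apply: (squeeze_cvgr H).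
  by rewrite -lox; exact: loc.
by rewrite -hix; exact: hic.
Qed.

Lemma near_eq_continuous f g x : (\forall y \near x, f y = g y) ->
  {for x, continuous f} -> {for x, continuous g}.
Proof.
move=> fg fc; apply: (@continuous_squeeze _ f f) => //.
- exact: nbhs_singleton fg.
- exact: nbhs_singleton fg.
- by near=> y; rewrite (near fg y) // lexx.
Unshelve. all: by end_near. Qed.

End Continuity.

(** * Linear forms and subgradients on row vectors *)

Section RowVectors.
Variables (R : realType) (m : nat).
Local Notation V := 'rV[R]_m.

Lemma coord_le_norm (u : V) i : `|u 0 i| <= `|u|.
Proof.
rewrite [leRHS]/Num.norm /= mx_normrE.
exact: (le_bigmax _ (fun k : 'I_1 * 'I_m => `|u k.1 k.2|) (0, i)).
Qed.

Lemma linear_coordE (l : {linear V -> R}) u :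
  l u = \sum_i u 0 i * l (delta_mx 0 i).
Proof.
rewrite {1}(row_sum_delta u) linear_sum; apply: eq_bigr => i _.
by rewrite linearZ.
Qed.

Lemma scalar_coordE (l : V -> R) u : scalar l ->
  l u = \sum_i u 0 i * l (delta_mx 0 i).
Proof.
move=> llin.
pose L : {linear V -> R} := HB.pack l (GRing.isLinear.Build _ _ _ _ _ llin).
exact: (linear_coordE L).
Qed.

Lemma linear_rV_continuous (l : {linear V -> R}) : continuous l.
Proof.
have -> : l = (fun u => \sum_i u 0 i * l (delta_mx 0 i)) :> (V -> R).
  by apply/funext => u; exact: linear_coordE.
move=> x; apply: continuous_sum => i.
by apply: continuousM; [exact: coord_continuous|exact: cst_continuous].
Qed.

(* F y - F x lies between D x (y - x) and D y (y - x), so no regularity of F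
   other than the continuity of its subgradients is needed. *)
Lemma is_diff_subgradient (F : V -> R) (D : V -> V -> R) x :
  (forall y, scalar (D y)) -> (forall u, {for x, continuous (D ^~ u)}) ->
  (\forall y \near x, D x (y - x) <= F y - F x /\ D y (x - y) <= F x - F y) ->
  is_diff x F (D x).
Proof.
move=> Dlin Dc DF.
pose L y : {linear V -> R} :=
  HB.pack (D y) (GRing.isLinear.Build _ _ _ _ _ (Dlin y)).
suff : is_diff x F (L x) by [].
have lc := @linear_rV_continuous (L x).
apply/(is_diffP _ _ lc) => e e0.
(* For the max norm on row vectors, the l1 size of the coefficients of [D y - D x] bounds its
   operator norm. *)
pose s y := \sum_i `|D y (delta_mx 0 i) - D x (delta_mx 0 i)|.
have sc : {for x, continuous s}.
  apply: continuous_sum => i; apply: continuous_norm.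
  by apply: continuousB; [exact: Dc|exact: cst_continuous].
have se : \forall y \near x, s y < e.
  apply: (continuous_near_lt sc).
  by rewrite /s big1 // => i _; rewrite subrr normr0.
near=> y.
have [Dx Dy] : D x (y - x) <= F y - F x /\ D y (x - y) <= F x - F y.
  by near: y.
rewrite ger0_norm ?subr_ge0 //.
apply: (@le_trans _ _ (L y (y - x) - L x (y - x))).
  by rewrite lerD2r -lerN2 opprB -linearN opprB.
rewrite (linear_coordE (L y)) (linear_coordE (L x)) -sumrB.
apply: le_trans (ler_norm _) _; apply: le_trans (ler_norm_sum _ _ _) _.
apply: (@le_trans _ _ (s y * `|y - x|)); last first.
  by rewrite ler_wpM2r // ltW //; near: y.
rewrite /s mulr_suml; apply: ler_sum => i _.
by rewrite -mulrBr normrM mulrC ler_wpM2l // coord_le_norm.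
Unshelve. all: by end_near. Qed.

Lemma is_diff_scalar_rV (l : V -> R) x : scalar l -> is_diff x l l.
Proof.
move=> llin.
pose L : {linear V -> R} := HB.pack l (GRing.isLinear.Build _ _ _ _ _ llin).
suff : is_diff x L L by [].
split; first exact/linear_differentiable/linear_rV_continuous.
by rewrite diff_lin //; exact: linear_rV_continuous.
Qed.

End RowVectors.
End DifferentiationLemmas.

(** * The exponential bound behind the support inequality *)

Section SupportInequality.
Set Implicit Arguments.
Unset Strict Implicit.

Lemma cos_sin_le_expR (R : realType) (c d : R) : - pi <= d <= pi ->
  cos d + c * sin d <= expR (c * d).
Proof.
move=> dpi.
pose f (t : R) : R := expR (- c * t) * (cos t + c * sin t).
have df (t : R) : is_derive t 1 f (- (1 + c ^+ 2) * expR (- c * t) * sin t).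
  have h1 : is_derive t 1 (fun t : R => - c * t) (- c).
    apply: is_derive_eq (is_deriveZ (- c) (is_derive_id t 1)) _.
    by rewrite /GRing.scale /= mulr1.
  have h : is_derive t 1 (fun t : R => expR (- c * t)) (expR (- c * t) * - c).
    exact: is_derive1_comp (is_derive_expR (- c * t)) h1.
  rewrite /f; apply: is_derive_eq.
  rewrite /GRing.scale /=; ring.
have fc : continuous f.
  move=> t.
  by apply: differentiable_continuous; apply/derivable1_diffP; apply: ex_derive.
(* By the sign of [sin], [f] increases on [-pi, 0] and decreases on [0, pi], so [f 0 = 1] is its
   maximum there. *)
suff f1 : f d <= 1.
  have -> : cos d + c * sin d = expR (c * d) * f d.
    by rewrite /f mulrA -expRD mulNr subrr expR0 mul1r.
  by rewrite ler_piMr // expR_ge0.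
have f0 : f 0 = 1 by rewrite /f mulr0 expR0 cos0 sin0 mulr0 addr0 mul1r.
have [d0|d0] := leP 0 d.
  have [e] := MVT_segment d0 (fun t _ => df t) (continuous_subspaceT fc).
  rewrite in_itv /= => /andP[e0 ed]; rewrite f0 => E.
  rewrite -subr_le0 E subr0 mulr_le0_ge0 // mulNr mulNr oppr_le0.
  rewrite !mulr_ge0 ?expR_ge0 ?addr_ge0 ?sqr_ge0 // sin_ge0_pi // e0 /=.
  by apply: le_trans ed _; case/andP: dpi.
have [e] := MVT_segment (ltW d0) (fun t _ => df t) (continuous_subspaceT fc).
rewrite in_itv /= => /andP[de e0]; rewrite f0 => E.
rewrite -subr_ge0 E sub0r mulr_ge0 //; last by rewrite oppr_ge0 ltW.
have se : sin e <= 0.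
  rewrite -oppr_ge0 -sinN sin_ge0_pi // oppr_ge0 e0 /= lerNl.
  by apply: le_trans de; case/andP: dpi.
rewrite -mulrA mulNr oppr_ge0 mulr_ge0_le0 ?addr_ge0 ?sqr_ge0 //.
by rewrite mulr_ge0_le0 ?expR_ge0.
Qed.

End SupportInequality.

Section Finsleroid.
Set Implicit Arguments.
Unset Strict Implicit.
Variables (R : realType) (n : nat) (r : 'M[R]_n) (g : R).
Hypothesis r_sym : r^T = r.
Hypothesis r_pd : forall v : 'rV[R]_n, v != 0 -> 0 < (v *m r *m v^T) 0 0.
Hypothesis hg_lo : -2 < g.
Hypothesis hg_hi : g < 2.
Implicit Types (x y u v w : 'rV[R]_n.+1) (t : R).

Let q := qf r.
Let Z := @Zc R n.
Let B := Bf r g.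
Let K := Kf r g.
Let h := hg g.
Let c := Gg g / 2.

(** * The semidefinite form of [r] on the whole space, with the Z-axis as kernel, and its seminorm
    [q] *)

Definition ip x y : R := (xa x *m r *m (xa y)^T) 0 0.

Lemma xaD x y : xa (x + y) = xa x + xa y.
Proof. by apply/rowP => i; rewrite !mxE. Qed.

Lemma xaZ t x : xa (t *: x) = t *: xa x.
Proof. by apply/rowP => i; rewrite !mxE. Qed.

Lemma ZcD x y : Z (x + y) = Z x + Z y.
Proof. by rewrite /Z /Zc !mxE. Qed.

Lemma ZcZ t x : Z (t *: x) = t * Z x.
Proof. by rewrite /Z /Zc !mxE. Qed.

Lemma xa_Zc_eq0 x : xa x = 0 -> Z x = 0 -> x = 0.
Proof.
move=> /rowP x0 z0; apply/rowP => i; rewrite mxE.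
have [lt_in|] := ltnP i n.
  have := x0 (Ordinal lt_in); rewrite !mxE => <-; congr (x 0 _).
  exact: val_inj.
rewrite leq_eqVlt ltnNge -ltnS ltn_ord orbF => /eqP ni.
by rewrite -[RHS]z0; congr (x 0 _); exact: val_inj.
Qed.

Lemma ipDl x y v : ip (x + y) v = ip x v + ip y v.
Proof. by rewrite /ip xaD !mulmxDl mxE. Qed.

Lemma ipZl t x v : ip (t *: x) v = t * ip x v.
Proof. by rewrite /ip xaZ -!scalemxAl mxE. Qed.

Lemma ipC x y : ip x y = ip y x.
Proof.
rewrite /ip -[in RHS]r_sym.
have -> : (xa y *m r^T *m (xa x)^T) = (xa x *m r *m (xa y)^T)^T.
  by rewrite !trmx_mul trmxK mulmxA.
by rewrite [RHS]mxE.
Qed.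

Lemma ipDr x y v : ip v (x + y) = ip v x + ip v y.
Proof. by rewrite ipC ipDl !(ipC v). Qed.

Lemma ipZr t x v : ip v (t *: x) = t * ip v x.
Proof. by rewrite ipC ipZl (ipC v). Qed.

Lemma ip_eq0 x : ip x x = 0 -> xa x = 0.
Proof.
by have [//|/r_pd] := eqVneq (xa x) 0; rewrite /ip => /[swap] ->; rewrite ltxx.
Qed.

Lemma ip_ge0 x : 0 <= ip x x.
Proof.
have [x0|/r_pd/ltW//] := eqVneq (xa x) 0.
by rewrite /ip x0 !mul0mx mxE.
Qed.

Lemma qf_ge0 x : 0 <= q x. Proof. exact: sqrtr_ge0. Qed.

Lemma qf_sqr x : q x ^+ 2 = ip x x. Proof. by rewrite sqr_sqrtr // ip_ge0. Qed.

Lemma qf_eq0 x : q x = 0 -> xa x = 0.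
Proof. by move=> q0; apply: ip_eq0; rewrite -qf_sqr q0 expr0n. Qed.

(** Cauchy-Schwarz: the form is nonnegative at [q y ^+ 2 *: x - ip x y *: y], where its value is
    [q y ^+ 2] times the gap between the squares. *)
Lemma ip_le x y : `|ip x y| <= q x * q y.
Proof.
have [q0|qN0] := eqVneq (q y) 0.
  by rewrite q0 mulr0 ipC /ip (qf_eq0 q0) !mul0mx mxE normr0.
have qy : 0 < q y by rewrite lt_neqAle eq_sym qN0 qf_ge0.
have := ip_ge0 (q y ^+ 2 *: x + (- ip x y) *: y).
rewrite !(ipDl, ipDr, ipZl, ipZr) (ipC y x) -!qf_sqr.
move=> H; rewrite -ler_sqr ?nnegrE ?mulr_ge0 ?qf_ge0 // real_normK ?num_real //.
have : 0 <= q y ^+ 2 * ((q x * q y) ^+ 2 - ip x y ^+ 2).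
  by move: H; congr (_ <= _); ring.
by rewrite pmulr_rge0 ?exprn_gt0 // subr_ge0 exprMn.
Qed.

(** * Positivity of B and K, and polar coordinates *)

Lemma hg_sqr : h ^+ 2 = 1 - g ^+ 2 / 4.
Proof. by rewrite sqr_sqrtr //; have := hg_lo; have := hg_hi; nra. Qed.

Lemma hg_gt0 : 0 < h.
Proof. by rewrite sqrtr_gt0; have := hg_lo; have := hg_hi; nra. Qed.

(** Completing the square in Z; this form controls [q]. *)
Lemma BfE x : B x = Af r g x ^+ 2 + (h * q x) ^+ 2.
Proof. by rewrite exprMn hg_sqr /B /Bf /Af /q; field. Qed.

(** Completing the square in [q] instead; this form controls Z. *)
Lemma BfE' x : B x = (q x + g / 2 * Z x) ^+ 2 + (h * Z x) ^+ 2.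
Proof. by rewrite exprMn hg_sqr /B /Bf /q /Z; field. Qed.

Lemma Bf_ge0 x : 0 <= B x.
Proof. by rewrite BfE addr_ge0 ?sqr_ge0. Qed.

Lemma qf_Zc_neq0 x : x != 0 -> q x = 0 -> Z x != 0.
Proof.
move=> x0 q0; apply: contra_neq x0 => z0.
exact: (xa_Zc_eq0 (qf_eq0 q0)).
Qed.

Lemma Bf_gt0 x : x != 0 -> 0 < B x.
Proof.
move=> x0; have [q0|qN0] := eqVneq (q x) 0.
  have zN0 := qf_Zc_neq0 x0 q0.
  rewrite BfE' ltr_wpDl ?sqr_ge0 // exprn_even_gt0 //= mulf_neq0 //.
  by rewrite gt_eqF ?hg_gt0.
rewrite BfE ltr_wpDl ?sqr_ge0 // exprn_even_gt0 //= mulf_neq0 //.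
by rewrite gt_eqF ?hg_gt0.
Qed.

Lemma Kf_gt0 x : x != 0 -> 0 < K x.
Proof.
move=> x0; rewrite /K /Kf (negbTE x0) mulr_gt0 ?expR_gt0 //.
by rewrite sqrtr_gt0 Bf_gt0.
Qed.

Lemma KfE x : K x = Num.sqrt (B x) * expR (c * Phif r g x).
Proof.
rewrite /K /Kf; case: eqP => [->|//].
have xa0 : xa (0 : 'rV[R]_n.+1) = 0 by apply/rowP => i; rewrite !mxE.
rewrite /B /Bf /qf xa0 !mul0mx /Zc !mxE sqrtr0 !mulr0 expr0n /= !addr0.
by rewrite sqrtr0 mul0r.
Qed.

Lemma Phif_bound x : - (pi / 2) <= Phif r g x <= pi / 2.
Proof.
rewrite /Phif; have := pi_ge0 R => p0.
case: ifP => _; first by rewrite !ltW ?atan_gtNpi2 ?atan_ltpi2.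
by case: ifP => _; [|case: ifP => _]; apply/andP; split; lra.
Qed.

(* Polar coordinates: the point (A, h q) has modulus sqrt B, and Phi is its
   angle, measured from the q-axis. *)
Lemma Phif_polar x : x != 0 ->
  Af r g x = Num.sqrt (B x) * sin (Phif r g x) /\
  h * q x = Num.sqrt (B x) * cos (Phif r g x).
Proof.
move=> x0; have h0 := hg_gt0.
have [qx|qx] := ltP 0 (q x).
  rewrite /Phif -/q qx -/h.
  have hq : 0 < h * q x by rewrite mulr_gt0.
  set t := Af r g x / (h * q x).
  have At : Af r g x = h * q x * t by rewrite mulrC divfK ?gt_eqF.
  have sB : Num.sqrt (B x) = h * q x * Num.sqrt (1 + t ^+ 2).
    have -> : B x = (h * q x) ^+ 2 * (1 + t ^+ 2) by rewrite BfE At; ring.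
    by rewrite sqrtrM ?sqr_ge0 // sqrtr_sqr gtr0_norm.
  have s0 : Num.sqrt (1 + t ^+ 2) != 0.
    by rewrite gt_eqF // sqrtr_gt0 ltr_pwDl ?sqr_ge0.
  have ct := cos_atan t.
  have st : sin (atan t) = t * cos (atan t).
    by rewrite -{2}(atanK t) /tan divfK // ct invr_eq0.
  by rewrite sB st ct At; split; field; rewrite s0.
have q0 : q x = 0 by apply/eqP; rewrite eq_le qx qf_ge0.
have zN0 := qf_Zc_neq0 x0 q0.
rewrite /Phif -/q q0 ltxx mulr0 /Af -/q q0 mulr0 addr0 -/Z.
have -> : Num.sqrt (B x) = `|Z x|.
  by rewrite /B /Bf -/q -/Z q0 mulr0 mul0r expr0n !addr0 sqrtr_sqr.
case: ltrgtP zN0 => [z0|z0|//] _.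
  by rewrite gtr0_norm // sin_pihalf cos_pihalf mulr1 mulr0.
by rewrite ltr0_norm // sinN cosN sin_pihalf cos_pihalf mulrN mulr1 mulr0 opprK.
Qed.

(* mf x u / B x is the derivative of ln K at x along u. *)
Definition mf x u : R := ip x u + (Z x + g * q x) * Z u.
Definition dK x u : R := K x * (mf x u / B x).

Lemma mf_id x : mf x x = B x.
Proof. by rewrite /mf -qf_sqr /B /Bf -/q -/Z; ring. Qed.

Lemma dK_id x : x != 0 -> dK x x = K x.
Proof. by move=> x0; rewrite /dK mf_id divff ?mulr1 // gt_eqF ?Bf_gt0. Qed.

(** Together with equality at [y = x] ([dK_id]), this makes [dK x] a subgradient of K at [x]. *)
Lemma dK_le x y : x != 0 -> dK x y <= K y.
Proof.
move=> x0; have [->|y0] := eqVneq y 0.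
  rewrite /dK /mf ipC /ip; have -> : xa (0 : 'rV[R]_n.+1) = 0.
    by apply/rowP => i; rewrite !mxE.
  by rewrite !mul0mx /Z /Zc !mxE mulr0 addr0 mul0r mulr0 /K /Kf eqxx.
have [Ax Qx] := Phif_polar x0; have [Ay Qy] := Phif_polar y0.
rewrite /dK !KfE.
have sx : 0 < Num.sqrt (B x) by rewrite sqrtr_gt0 Bf_gt0.
have sy : 0 < Num.sqrt (B y) by rewrite sqrtr_gt0 Bf_gt0.
have BE : B x = Num.sqrt (B x) ^+ 2 by rewrite sqr_sqrtr ?Bf_ge0.
rewrite {2}BE.
set rx := Num.sqrt (B x) in sx BE Ax Qx *.
set ry := Num.sqrt (B y) in sy Ay Qy *.
set a := Phif r g x in Ax Qx *; set b := Phif r g y in Ay Qy *.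
have h0 := hg_gt0; have h2 := hg_sqr.
(* Once Cauchy-Schwarz has replaced [ip x y] by [q x * q y], the bound is an identity in polar
   coordinates: the two sides differ by a multiple of [h ^+ 2 - 1 + g ^+ 2 / 4], which is 0. *)
have key : mf x y <= rx * ry * (cos (b - a) + c * sin (b - a)).
  apply: (@le_trans _ _ (q x * q y + (Z x + g * q x) * Z y)).
    by rewrite lerD2r (le_trans (ler_norm _)) // ip_le.
  have qE : q x = rx * cos a / h by rewrite -Qx mulrC mulKf ?gt_eqF.
  have qE' : q y = ry * cos b / h by rewrite -Qy mulrC mulKf ?gt_eqF.
  have zE : Z x = rx * sin a - g / 2 * (rx * cos a / h).
    by rewrite -Ax -qE /Af -/q -/Z; ring.
  have zE' : Z y = ry * sin b - g / 2 * (ry * cos b / h).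
    by rewrite -Ay -qE' /Af -/q -/Z; ring.
  rewrite zE zE' qE qE' cosB sinB /c /Gg -/h.
  rewrite -subr_ge0 le_eqVlt; apply/orP; left; apply/eqP.
  have -> : rx * ry * (cos b * cos a + sin b * sin a
        + g / h / 2 * (sin b * cos a - cos b * sin a))
      - (rx * cos a / h * (ry * cos b / h)
        + (rx * sin a - g / 2 * (rx * cos a / h) + g * (rx * cos a / h))
          * (ry * sin b - g / 2 * (ry * cos b / h)))
      = rx * ry * cos a * cos b / h ^+ 2 * (h ^+ 2 - 1 + g ^+ 2 / 4).
    by field; rewrite gt_eqF.
  by rewrite h2; ring.
(* Both angles lie in [-pi/2, pi/2], so [b - a] is in the range of the exponential bound. *)
have := @cos_sin_le_expR R c (b - a).
have := Phif_bound x; have := Phif_bound y; rewrite -/a -/b.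
move=> /andP[b1 b2] /andP[a1 a2] /(_ _)/wrap[]; first by apply/andP; split; lra.
move=> ce.
have -> : ry * expR (c * b) =
    rx * expR (c * a) * (rx * ry * expR (c * (b - a)) / rx ^+ 2).
  have -> : c * b = c * a + c * (b - a) by ring.
  by rewrite expRD; field; rewrite gt_eqF.
rewrite ler_pM2l ?mulr_gt0 ?expR_gt0 // ler_pM2r ?invr_gt0 ?exprn_gt0 //.
by rewrite (le_trans key) // ler_pM2l // mulr_gt0.
Qed.

(** * Linearity and continuity of the building blocks *)

Lemma ip_scalar v : scalar (ip ^~ v).
Proof. by move=> a x y; rewrite ipDl ipZl. Qed.

Lemma Zc_scalar : scalar Z.
Proof. by move=> a x y; rewrite ZcD ZcZ. Qed.

Lemma mf_scalar x : scalar (mf x).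
Proof. by move=> a u v; rewrite /mf ipDr ipZr ZcD ZcZ; ring. Qed.

Lemma dKD x u v : dK x (u + v) = dK x u + dK x v.
Proof. by rewrite /dK /mf ipDr ZcD; ring. Qed.

Lemma dKZ a x u : dK x (a *: u) = a * dK x u.
Proof. by rewrite /dK /mf ipZr ZcZ; ring. Qed.

Lemma dK_scalar x : scalar (dK x).
Proof. by move=> a u v; rewrite dKD dKZ. Qed.

Lemma ip_continuous v : continuous (ip ^~ v).
Proof.
move=> x; have [dx _] := is_diff_scalar_rV x (ip_scalar v).
exact: differentiable_continuous.
Qed.

Lemma Zc_continuous : continuous Z.
Proof.
move=> x; have [dx _] := is_diff_scalar_rV x Zc_scalar.
exact: differentiable_continuous.
Qed.

Lemma ip_diag_continuous : continuous (fun x => ip x x).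
Proof.
have -> : (fun x => ip x x) = fun x => \sum_i x 0 i * ip x (delta_mx 0 i).
  apply/funext => x; apply: (@scalar_coordE _ _ (ip x)) => a u v.
  by rewrite ipDr ipZr.
move=> x; apply: continuous_sum => i.
by apply: continuousM; [exact: coord_continuous|exact: ip_continuous].
Qed.

Lemma qf_continuous : continuous q.
Proof.
move=> x; apply: continuous_comp; first exact: ip_diag_continuous.
exact: sqrt_continuous.
Qed.

Lemma Bf_continuous : continuous B.
Proof.
move=> x; have qc := @qf_continuous x; have zc := @Zc_continuous x.
have gc := @cst_continuous 'rV[R]_n.+1 R g x.
have H := continuousD (continuousD (continuousM zc zc)
  (continuousM (continuousM gc qc) zc)) (continuousM qc qc).
have -> : B = (fun y => Z y * Z y + g * q y * Z y + q y * q y) by [].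
exact: H.
Qed.

Lemma mf_continuous u : continuous (mf ^~ u).
Proof.
move=> x; have qc := @qf_continuous x; have zc := @Zc_continuous x.
have gc := @cst_continuous 'rV[R]_n.+1 R g x.
have uc := @cst_continuous 'rV[R]_n.+1 R (Z u) x.
exact: (continuousD (@ip_continuous u x)
  (continuousM (continuousD zc (continuousM gc qc)) uc)).
Qed.

Lemma Bf_inv_continuous x : x != 0 -> {for x, continuous (fun y => (B y)^-1)}.
Proof.
move=> x0; apply: continuousV; first by rewrite gt_eqF ?Bf_gt0.
exact: Bf_continuous.
Qed.

Lemma mf_div_continuous u x : x != 0 ->
  {for x, continuous (fun y => mf y u / B y)}.
Proof.
move=> x0; apply: continuousM; first exact: mf_continuous.
exact: Bf_inv_continuous.
Qed.

Lemma near_neq0 x : x != 0 -> \forall y \near x, y != 0.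
Proof.
move=> x0; have Bx := Bf_gt0 x0.
have := continuous_near_gt (@Bf_continuous x) Bx.
apply: filterS => y; apply: contraTneq => ->; rewrite -leNgt.
have xa0 : xa (0 : 'rV[R]_n.+1) = 0 by apply/rowP => i; rewrite !mxE.
by rewrite /B /Bf /qf xa0 !mul0mx /Zc !mxE sqrtr0 !mulr0 expr0n /= !addr0.
Qed.

(** The support inequality squeezes K without any look at the cases of [Phif]: [dK x y <= K y] from
    below, and [dK y x <= K x], divided by [mf y x / B y], from above. That divisor tends to 1. *)
Lemma Kf_continuous_neq0 x : x != 0 -> {for x, continuous K}.
Proof.
move=> x0; have Kc := @cst_continuous 'rV[R]_n.+1 R (K x) x.
have Bc := @cst_continuous 'rV[R]_n.+1 R (B x)^-1 x.
have BN0 : B x != 0 by rewrite gt_eqF ?Bf_gt0.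
pose f y := mf y x / B y.
have fc : {for x, continuous f} := mf_div_continuous x0.
have fx : f x = 1 by rewrite /f mf_id divff.
have fxN0 : f x != 0 by rewrite fx oner_eq0.
apply: (@continuous_squeeze _ _ _ (dK x) (fun y => K x * (f y)^-1)).
- apply: continuousM => //; apply: continuousM => //.
  have [dx _] := is_diff_scalar_rV x (mf_scalar x).
  exact: differentiable_continuous.
- exact: (continuousM Kc (continuousV fxN0 fc)).
- exact: dK_id.
- by rewrite fx invr1 mulr1.
have f0 : \forall y \near x, 0 < f y.
  by apply: (continuous_near_gt fc); rewrite fx.
have yN0 := near_neq0 x0.
near=> y; rewrite dK_le //=.
have fy : 0 < f y by near: y.
by rewrite ler_pdivlMr //; apply: dK_le; near: y.
Unshelve. all: by end_near. Qed.

Lemma dK_continuous u x : x != 0 -> {for x, continuous (dK ^~ u)}.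
Proof.
move=> x0; apply: continuousM; first exact: Kf_continuous_neq0.
exact: mf_div_continuous.
Qed.

(** * First and second derivatives of K *)

Lemma is_diff_Kf x : x != 0 -> is_diff x K (dK x).
Proof.
move=> x0; apply: is_diff_subgradient; first exact: dK_scalar.
  by move=> u; exact: dK_continuous.
have dB (a b d : 'rV[R]_n.+1) : dK a (b - d) = dK a b - dK a d.
  by rewrite -scaleN1r dKD dKZ mulN1r.
have yN0 := near_neq0 x0.
near=> y; have y0 : y != 0 by near: y.
by rewrite !dB !dK_id //; split; rewrite lerD2r dK_le.
Unshelve. all: by end_near. Qed.

(** The subgradient inequality is the nonnegativity of the form at [b - a]. Unlike [q], its square
    is smooth on the axis too. *)
Lemma is_diff_qf_sqr x : is_diff x (fun y => q y ^+ 2) (fun u => 2 * ip x u).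
Proof.
have -> : (fun y => q y ^+ 2) = (fun y => ip y y).
  by apply/funext => y; rewrite qf_sqr.
apply: (@is_diff_subgradient _ _ _ (fun x u => 2 * ip x u)).
- by move=> y a u v; rewrite ipDr ipZr; ring.
- move=> u; apply: continuousM; [exact: cst_continuous|exact: ip_continuous].
have H a b : 2 * ip a (b - a) <= ip b b - ip a a.
  have := ip_ge0 (b - a); rewrite -scaleN1r !(ipDl, ipDr, ipZl, ipZr) (ipC b a).
  lra.
by near=> y; split; exact: H.
Unshelve. all: by end_near. Qed.

(** Here the subgradient inequality is Cauchy-Schwarz divided by [q]. *)
Lemma is_diff_qf x : 0 < q x -> is_diff x q (fun u => ip x u / q x).
Proof.
move=> qx; apply: (@is_diff_subgradient _ _ _ (fun x u => ip x u / q x)).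
- by move=> y a u v; rewrite ipDr ipZr; ring.
- move=> u; apply: continuousM; first exact: ip_continuous.
  by apply: continuousV; [rewrite gt_eqF|exact: qf_continuous].
have H a b : 0 < q a -> ip a (b - a) / q a <= q b - q a.
  move=> qa; rewrite ler_pdivrMr // mulrBl -expr2 qf_sqr.
  rewrite -scaleN1r ipDr ipZr mulN1r lerD2r (le_trans (ler_norm _)) // mulrC.
  exact: ip_le.
have qN0 := continuous_near_gt (@qf_continuous x) qx.
by near=> y; split; apply: H => //; near: y.
Unshelve. all: by end_near. Qed.

(* The derivative of mf x v / B x along u, also at q x = 0, where the junk value
   ip x u / q x = 0 multiplies a factor that vanishes. *)
Definition dmB x u v : R :=
  (ip u v + Z u * Z v) / B x
  - mf x v * (2 * Z x * Z u + g * q x * Z u + 2 * ip x u) / B x ^+ 2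
  + g * (ip x u / q x) * (Z v * q x ^+ 2 - ip x v * Z x) / B x ^+ 2.

Lemma qf0_ip x u : q x = 0 -> ip x u = 0.
Proof. by move=> q0; rewrite /ip (qf_eq0 q0) !mul0mx mxE. Qed.

Lemma is_diff_mf_div v x : x != 0 ->
  is_diff x (fun y => mf y v / B y) (fun u => dmB x u v).
Proof.
move=> x0; have BN0 : B x != 0 by rewrite gt_eqF ?Bf_gt0.
have iz := is_diff_scalar_rV x Zc_scalar.
have iv := is_diff_scalar_rV x (ip_scalar v).
have [q0|qN0] := eqVneq (q x) 0.
  have zN0 := qf_Zc_neq0 x0 q0.
  (* mf y v / B y = Z v / Z y + f0 y / B y, and B need only be continuous
     because f0 x = 0. *)
  pose f0 y := ip y v - Z v * (Z y)^-1 * q y ^+ 2.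
  have iq := is_diff_qf_sqr x.
  have iZV := is_diff_inv iz zN0.
  (* On the axis both [q ^+ 2] and its differential vanish, so only the linear term of [f0]
     survives. *)
  have iF : is_diff x f0 (ip ^~ v).
    apply: is_diff_eq (is_diffB iv (is_diffM (is_diffZ (Z v) iZV) iq)) _.
    apply/funext => u; rewrite /= !fctE /GRing.scale /= q0 (qf0_ip u q0).
    by rewrite /GRing.scale /=; ring.
  have f00 : f0 x = 0 by rewrite /f0 q0 qf0_ip //; ring.
  have iM := is_diff_vanishM (Bf_inv_continuous x0) iF f00.
  have iS := is_diffD (is_diffZ (Z v) iZV) iM.
  apply: (near_eq_is_diff _ (is_diff_eq iS _)).
    have zN := continuous_near_gt (continuous_norm (@Zc_continuous x))
      (_ : 0 < `|Z x|).
    have yN0 := near_neq0 x0.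
    near=> y; rewrite !fctE /GRing.scale /= /f0 /mf.
    have Zy : Z y != 0.
      by rewrite -normr_gt0; near: y; apply: zN; rewrite normr_gt0.
    have By : B y != 0 by rewrite gt_eqF // Bf_gt0 //; near: y.
    have BE : B y = Z y ^+ 2 + g * q y * Z y + q y ^+ 2 by [].
    by rewrite BE in By *; field; rewrite By.
  apply/funext => u; rewrite /= !fctE /GRing.scale /= /dmB /mf q0.
  rewrite !(qf0_ip _ q0) invr0.
  have -> : B x = Z x ^+ 2.
    by rewrite /B /Bf -/q -/Z q0 mulr0 mul0r expr0n !addr0.
  by field.
have qx : 0 < q x by rewrite lt_neqAle eq_sym qN0 qf_ge0.
have iq := is_diff_qf qx.
have iB : is_diff x B (fun u => 2 * Z x * Z u
    + g * (ip x u / q x * Z x + q x * Z u) + 2 * ip x u).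
  have iB' := is_diffD (is_diffD (is_diffM iz iz)
    (is_diffM (is_diffZ g iq) iz)) (is_diffM iq iq).
  apply: is_diff_eq iB' _.
  by apply/funext => u; rewrite /= !fctE /GRing.scale /=; field.
have iM := is_diffM
  (is_diffD iv (is_diffZ (Z v) (is_diffD iz (is_diffZ g iq))))
  (is_diff_inv iB BN0).
have -> : (fun y => mf y v / B y) =
    (ip^~ v + Z v *: (Z + g *: q)) * (fun y => (B y)^-1).
  by apply/funext => y; rewrite !fctE /GRing.scale /= /mf; ring.
apply: is_diff_eq iM _.
apply/funext => u; rewrite /= !fctE /GRing.scale /= /dmB /mf.
have BE : B x = Z x ^+ 2 + g * q x * Z x + q x ^+ 2 by [].
by rewrite BE in BN0 *; field; rewrite BN0.
Unshelve. all: by end_near. Qed.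

Definition ddK x u v : R :=
  dK x u * (mf x v / B x) + K x * dmB x u v.

Lemma is_diff_dK v x : x != 0 -> is_diff x (dK ^~ v) (fun u => ddK x u v).
Proof.
move=> x0.
have iM := is_diffM (is_diff_Kf x0) (is_diff_mf_div v x0).
apply: is_diff_eq iM _; apply/funext => u.
by rewrite !fctE /GRing.scale /= /ddK addrC mulrC [X in X + _]mulrC.
Qed.

Lemma derive_Kf v x : x != 0 -> 'D_v K x = dK x v.
Proof. by move=> x0; apply: is_diff_derive; exact: is_diff_Kf. Qed.

Lemma is_diff_derive_Kf v x : x != 0 ->
  is_diff x ('D_v K) (fun u => ddK x u v).
Proof.
move=> x0; apply: near_eq_is_diff (is_diff_dK v x0).
by apply: filterS (near_neq0 x0) => y y0; rewrite derive_Kf.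
Qed.

Lemma derive2_Kf u v x : x != 0 -> 'D_u ('D_v K) x = ddK x u v.
Proof. by move=> x0; apply: (is_diff_derive (is_diff_derive_Kf v x0)). Qed.

(** The only delicate factor is [ip y u / q y] at the axis. Cauchy-Schwarz bounds it by [q u], and
    its cofactor [w] is continuous and vanishes there. *)
Lemma dmB_continuous u v x : x != 0 -> {for x, continuous (fun y => dmB y u v)}.
Proof.
move=> x0.
have cc (a : R) := @cst_continuous 'rV[R]_n.+1 R a x.
have qc := @qf_continuous x; have zc := @Zc_continuous x.
have uc := @ip_continuous u x; have vc := @ip_continuous v x.
have Bc := Bf_inv_continuous x0; have Bc2 := continuousM Bc Bc.
pose w y := (Z v * (q y * q y) - ip y v * Z y) * ((B y)^-1 * (B y)^-1).
have wc : {for x, continuous w} := continuousM (continuousB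
  (continuousM (cc (Z v)) (continuousM qc qc)) (continuousM vc zc)) Bc2.
have ec : {for x, continuous (fun y => ip y u / q y * w y)}.
  have [q0|qN0] := eqVneq (q x) 0; last first.
    by apply: continuousM => //; apply: continuousM => //; exact: continuousV.
  have wx : w x = 0 by rewrite /w q0 (qf0_ip v q0); ring.
  have bc := continuousM (cc (q u)) (continuous_norm wc).
  apply: (continuous_squeeze (continuousN bc) bc).
  - by rewrite /= wx normr0 !mulr0 oppr0.
  - by rewrite /= wx normr0 !mulr0.
  near=> y; rewrite -ler_norml normrM ler_wpM2r //.
  (* On the axis division by zero yields 0, so the bound by [q u] persists. *)
  have [q0'|qN0] := eqVneq (q y) 0.
    by rewrite q0' invr0 mulr0 normr0 qf_ge0.
  have qy : 0 < q y by rewrite lt_neqAle eq_sym qN0 qf_ge0.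
  by rewrite normrM normfV (gtr0_norm qy) ler_pdivrMr // mulrC ip_le.
have main : {for x, continuous (fun y => (ip u v + Z u * Z v) * (B y)^-1
    - mf y v * (2 * Z y * Z u + g * q y * Z u + 2 * ip y u)
      * ((B y)^-1 * (B y)^-1)
    + g * (ip y u / q y * w y))} :=
  continuousD (continuousB (continuousM (cc (ip u v + Z u * Z v)) Bc)
    (continuousM (continuousM (@mf_continuous v x)
      (continuousD (continuousD
        (continuousM (continuousM (cc 2) zc) (cc (Z u)))
        (continuousM (continuousM (cc g) qc) (cc (Z u))))
        (continuousM (cc 2) uc))) Bc2))
    (continuousM (cc g) ec).
apply: (near_eq_continuous _ main).
have yN0 := near_neq0 x0.
near=> y; have By : B y != 0 by rewrite gt_eqF // Bf_gt0 //; near: y.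
by rewrite /w /dmB; move: (ip y u / q y) => s; field.
Unshelve. all: by end_near. Qed.

Lemma ddK_continuous u v x : x != 0 -> {for x, continuous (fun y => ddK y u v)}.
Proof.
move=> x0; apply: continuousD.
  by apply: continuousM; [exact: dK_continuous|exact: mf_div_continuous].
by apply: continuousM; [exact: Kf_continuous_neq0|exact: dmB_continuous].
Qed.

Lemma C2_near_Kf x : x != 0 -> C2_near K x.
Proof.
move=> x0; apply: filterS (near_neq0 x0) => y y0; split=> [|v|u v].
- by have [] := is_diff_Kf y0.
- by have [] := is_diff_derive_Kf v y0.
apply: (@near_eq_continuous R 'rV[R]_n.+1 (fun z => ddK z u v)); last first.
  exact: ddK_continuous.
by apply: filterS (near_neq0 y0) => z z0; rewrite derive2_Kf.
Qed.

(** * The unit sublevel set as a convex body bounded by the level set *)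

Lemma Kf0 : K 0 = 0.
Proof. by rewrite /K /Kf eqxx. Qed.

(** Since Phi is bounded by pi/2 in absolute value, J stays between [M^-1] and [M]. Comparing K with
    [sqrt B] gives continuity at the origin and boundedness of the sublevel set. *)
Lemma Kf_bounds x (M := expR (`|c| * (pi / 2))) :
  Num.sqrt (B x) <= M * K x /\ K x <= M * Num.sqrt (B x).
Proof.
have /andP[p1 p2] := Phif_bound x.
have : `|c * Phif r g x| <= `|c| * (pi / 2).
  by rewrite normrM ler_wpM2l // ler_norml p1.
rewrite ler_norml => /andP[c1 c2].
rewrite KfE; split.
  rewrite mulrCA ler_peMr ?sqrtr_ge0 // -expRD -[leLHS]expR0 ler_expR; lra.
by rewrite mulrC ler_wpM2r ?sqrtr_ge0 // ler_expR.
Qed.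

Lemma Kf_continuous : continuous K.
Proof.
move=> x; have [->|/Kf_continuous_neq0//] := eqVneq x 0.
have B0 : Num.sqrt (B 0) = 0.
  have := (Kf_bounds 0).1; rewrite Kf0 mulr0 => b0.
  by apply/eqP; rewrite eq_le b0 sqrtr_ge0.
pose M : R := expR (`|c| * (pi / 2)).
apply: (@continuous_squeeze _ _ _ (fun=> 0) (fun y => M * Num.sqrt (B y))).
- exact: cst_continuous.
- apply: continuousM; first exact: cst_continuous.
  by apply: continuous_comp; [exact: Bf_continuous|exact: sqrt_continuous].
- by rewrite Kf0.
- by rewrite Kf0 B0 mulr0.
near=> y; rewrite (Kf_bounds y).2 andbT KfE.
by rewrite mulr_ge0 ?sqrtr_ge0 ?expR_ge0.
Unshelve. all: by end_near. Qed.

Lemma r_unitmx : r \in unitmx.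
Proof.
rewrite -row_free_unit; apply/inj_row_free => v vr0.
apply/eqP; apply: contraTT isT => /r_pd; by rewrite vr0 mul0mx mxE ltxx.
Qed.

(* Coordinates are bounded in terms of q because the a-th one is
   <x, r^-1 e_a>, to which Cauchy-Schwarz applies. *)
Lemma xa_bound (a : 'I_n) :
  exists2 k : R, 0 <= k & forall x, `|xa x 0 a| <= k * q x.
Proof.
pose w : 'rV[R]_n.+1 :=
  \row_i (if unlift ord_max i is Some j then invmx r j a else 0).
exists (q w); first exact: qf_ge0.
move=> x; rewrite mulrC; have -> : xa x 0 a = ip x w; last exact: ip_le.
have xaw : (xa w)^T = col a (invmx r).
  apply/colP => j; rewrite !mxE.
  have -> : widen_ord (leqnSn n) j = lift ord_max j.
    by apply: ord_inj; rewrite lift_max.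
  by rewrite liftK.
rewrite /ip xaw -[in LHS](mulmxK r_unitmx (xa x)) [LHS]mxE [RHS]mxE.
by apply: eq_bigr => j _; rewrite [col _ _ _ _]mxE.
Qed.

(** [K x <= 1] bounds [sqrt B] by [M]; the two completed squares then bound [q] and [|Z|] by
    [M / h], and [q] bounds the other coordinates. *)
Lemma Kf_sublevel_bounded : bounded_set [set x | K x <= 1].
Proof.
have h0 := hg_gt0.
pose M : R := expR (`|c| * (pi / 2)).
have M0 : 0 < M by exact: expR_gt0.
have sB x : K x <= 1 -> Num.sqrt (B x) <= M.
  move=> Kx; apply: le_trans (Kf_bounds x).1 _.
  by rewrite -[leRHS]mulr1 ler_pM2l.
have sqrt_bound x (a b : R) :
    B x = a ^+ 2 + (h * b) ^+ 2 -> K x <= 1 -> `|b| <= M / h.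
  move=> BE /sB sM; rewrite ler_pdivlMr // mulrC; apply: le_trans sM.
  rewrite -{1}(gtr0_norm h0) -normrM -sqrtr_sqr ler_wsqrtr //.
  by rewrite BE lerDr sqr_ge0.
have qM x : K x <= 1 -> q x <= M / h.
  by move=> /(sqrt_bound x _ _ (BfE x)); rewrite ger0_norm ?qf_ge0.
have zM x : K x <= 1 -> `|Z x| <= M / h by exact: sqrt_bound (BfE' x).
have /choice[k kP] : forall a : 'I_n, exists k : R,
    0 <= k /\ forall x, `|xa x 0 a| <= k * q x.
  by move=> a; have [k k0 kx] := xa_bound a; exists k.
(* A sum of nonnegative bounds dominates each coordinate bound at once. *)
pose C := M / h + \sum_a k a * (M / h).
have Mh : 0 <= M / h by rewrite divr_ge0 // ltW.
have k0 a : 0 <= k a * (M / h) by rewrite mulr_ge0 //; exact: (kP a).1.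
have C0 : 0 <= C by rewrite addr_ge0 ?sumr_ge0.
exists C; split=> [|t Ct x Kx]; first exact: num_real.
apply: le_trans (ltW Ct).
rewrite /Num.norm /= mx_normrE; apply: bigmax_le => // -[i j] _ /=.
rewrite ord1; case: (unliftP ord_max j) => [a ->|->].
  have -> : x 0 (lift ord_max a) = xa x 0 a.
    by rewrite mxE; congr (x 0 _); apply: ord_inj; rewrite lift_max.
  apply: le_trans ((kP a).2 x) _; rewrite /C (bigD1 a) //= addrCA.
  rewrite -[leLHS]addr0 lerD //; last by rewrite addr_ge0 ?sumr_ge0.
  by rewrite ler_wpM2l ?qM //; exact: (kP a).1.
apply: le_trans (zM x Kx) _; by rewrite /C lerDl sumr_ge0.
Qed.

(** At a nonzero convex combination z, [K z = dK z z] is the same combination of [dK z x] and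
    [dK z y], each at most 1 by the support inequality. *)
Lemma Kf_sublevel_convex : convex [set x | K x <= 1].
Proof.
move=> x y t /andP[t0 t1] /= Kx Ky.
have [->|z0] := eqVneq (t *: x + (1 - t) *: y) 0; first by rewrite Kf0.
rewrite -dK_id // dKD !dKZ.
have dx := le_trans (dK_le x z0) Kx; have dy := le_trans (dK_le y z0) Ky.
nra.
Qed.

Lemma Kf_sublevel_compact : compact [set x | K x <= 1].
Proof.
apply: bounded_closed_compact; first exact: Kf_sublevel_bounded.
apply: (@preimage_closed _ _ K [set t | t <= 1]); last exact: closed_le.
by move=> x _; exact: Kf_continuous.
Qed.

Lemma Kf_level_compact : compact [set x | K x = 1].
Proof.
apply: (subclosed_compact _ Kf_sublevel_compact).
  apply: (@preimage_closed _ _ K [set t | t = 1]); last exact: closed_eq.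
  by move=> x _; exact: Kf_continuous.
by move=> x /= ->.
Qed.

Lemma Kf_lt1_interior x : K x < 1 -> interior [set x | K x <= 1] x.
Proof.
move=> Kx; have := continuous_near_lt (@Kf_continuous x) Kx.
by apply: filterS => y /ltW.
Qed.

Lemma Kf_level_neq0 x : K x = 1 -> x != 0.
Proof.
move=> Kx; apply: contraPneq Kx => ->; rewrite Kf0 => /esym/eqP.
by rewrite oner_eq0.
Qed.

(* Along the ray through x the support inequality gives K (t x) >= t K x. *)
Lemma Kf_level_boundary :
  [set x | K x = 1] = [set x | K x <= 1] `\` interior [set x | K x <= 1].
Proof.
apply/seteqP; split=> x /=.
  move=> Kx; have x0 := Kf_level_neq0 Kx; split; first by rewrite Kx.
  move=> intx.
  have tc : {for (1 : R), continuous (fun t : R => t *: x)}.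
    exact: scalel_continuous.
  have : \forall t \near (1 : R), K (t *: x) <= 1.
    move: intx; rewrite -{1}(scale1r x) => intx.
    exact: (tc _ intx).
  move=> [e /= e0 /(_ (1 + e / 2))]; rewrite /ball_ /= => /(_ _)/wrap[].
    rewrite opprD addNKr normrN gtr0_norm ?divr_gt0 // ltr_pdivrMr //.
    by rewrite ltr_pMr // ltr1n.
  apply/negP; rewrite -ltNge; apply: lt_le_trans (dK_le _ x0).
  by rewrite dKZ dK_id // Kx mulr1 ltrDl divr_gt0.
move=> [Kx nx]; apply/eqP; rewrite eq_le Kx leNgt /=.
by apply/negP => /Kf_lt1_interior.
Qed.

(** * The gradient and the second fundamental form *)

Lemma edot_grad x u : x != 0 -> edot u (grad K x) = dK x u.
Proof.
move=> x0; rewrite (scalar_coordE u (dK_scalar x)) /edot mxE.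
by apply: eq_bigr => i _; rewrite !mxE derive_Kf.
Qed.

(** Euler's relation: pairing the gradient with [x] itself gives [K x], which is positive. *)
Lemma grad_Kf_neq0 x : x != 0 -> grad K x != 0.
Proof.
move=> x0; have Kx := Kf_gt0 x0.
apply: contraTneq Kx => g0; rewrite -dK_id // -edot_grad // g0.
by rewrite /edot trmx0 mulmx0 mxE ltxx.
Qed.

Lemma ddK_tangent_gt0 x u : x != 0 -> u != 0 -> dK x u = 0 -> 0 < ddK x u u.
Proof.
move=> x0 u0 dK0; have Bx := Bf_gt0 x0; have Kx := Kf_gt0 x0.
have mf0 : mf x u = 0.
  move/eqP: dK0; rewrite /dK mulf_eq0 (gt_eqF Kx) /= mulf_eq0 invr_eq0.
  by rewrite (gt_eqF Bx) orbF => /eqP.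
rewrite /ddK dK0 mul0r add0r mulr_gt0 // /dmB mf0 !mul0r subr0.
have ipE : ip x u = - (Z x + g * q x) * Z u by move: mf0; rewrite /mf; lra.
set s := ip x u / q x.
(* Cauchy-Schwarz off the axis; on it [s] is 0 by the convention for division. *)
have sq : s ^+ 2 <= q u ^+ 2.
  rewrite -real_normK ?num_real // ler_sqr ?nnegrE ?qf_ge0 //.
  rewrite /s; have [q0|qN0] := eqVneq (q x) 0.
    by rewrite q0 invr0 mulr0 normr0 qf_ge0.
  have qx : 0 < q x by rewrite lt_neqAle eq_sym qN0 qf_ge0.
  by rewrite normrM normfV (gtr0_norm qx) ler_pdivrMr // mulrC ip_le.
have -> : (ip u u + Z u * Z u) / B x
    + g * s * (Z u * q x ^+ 2 - ip x u * Z x) / B x ^+ 2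
    = (q u ^+ 2 + Z u ^+ 2 + g * s * Z u) / B x.
  have BE : B x = Z x ^+ 2 + g * q x * Z x + q x ^+ 2 by [].
  rewrite (qf_sqr u) ipE.
  (* Tangency turns this factor into a multiple of [B x], which cancels one power of B. *)
  have -> : Z u * q x ^+ 2 - - (Z x + g * q x) * Z u * Z x = Z u * B x.
    by rewrite BE; ring.
  by field; rewrite gt_eqF.
rewrite divr_gt0 //.
have h2 := hg_sqr; have h0 := hg_gt0.
(* If [Z u] vanishes, the numerator is [q u ^+ 2], positive since [u] is nonzero. Otherwise
   replacing [q u ^+ 2] by [s ^+ 2] leaves at least [(s + g / 2 * Z u) ^+ 2 + (h * Z u) ^+ 2]. *)
have [zu|zu] := eqVneq (Z u) 0.
  rewrite zu mulr0 expr0n !addr0 exprn_gt0 // lt_neqAle qf_ge0 andbT eq_sym.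
  by apply: contraNneq u0 => /qf_eq0 xu; exact/eqP/xa_Zc_eq0.
have : 0 < (h * Z u) ^+ 2 by rewrite exprn_even_gt0 //= mulf_neq0 // gt_eqF.
rewrite exprMn h2 => hz.
have : 0 <= (s + g / 2 * Z u) ^+ 2 by exact: sqr_ge0.
have -> : (s + g / 2 * Z u) ^+ 2 =
    s ^+ 2 + g * s * Z u + g ^+ 2 / 4 * Z u ^+ 2 by field.
lra.
Qed.

Lemma sff_Kf_gt0 x u : x != 0 -> u != 0 -> tangent K x u -> 0 < sff K x u u.
Proof.
move=> x0 u0; rewrite /tangent edot_grad // => dK0.
rewrite /sff derive2_Kf // divr_gt0 ?ddK_tangent_gt0 // sqrtr_gt0.
have /eqP/rowP gN0 := grad_Kf_neq0 x0.
have edotE (p : 'rV[R]_n.+1) : edot p p = \sum_i p 0 i ^+ 2.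
  by rewrite /edot mxE; apply: eq_bigr => i _; rewrite mxE expr2.
rewrite edotE lt_neqAle eq_sym sumr_ge0 ?andbT => [|i _]; last exact: sqr_ge0.
apply/negP => /eqP/psumr_eq0P H; apply: gN0 => i.
rewrite [RHS]mxE; apply/eqP; rewrite -sqrf_eq0; apply/eqP/H => // j _.
exact: sqr_ge0.
Qed.

End Finsleroid.

Theorem theorem2p11 (R : realType) (n : nat) (hn : (1 <= n)%N)
  (r : 'M[R]_n) (r_sym : r^T = r)
  (r_pd : forall v : 'rV[R]_n, v != 0 -> 0 < (v *m r *m v^T) 0 0)
  (g : R) (hg_lo : -2 < g) (hg_hi : g < 2) :
  let K := Kf r g in
  let I := [set x : 'rV[R]_n.+1 | K x = 1] in
  let C := [set x : 'rV[R]_n.+1 | K x <= 1] in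
  [/\ (* closed (compact) hypersurface *)
      compact I,
      (* regular: K is C^2 near every point of I, with nonvanishing gradient *)
      (forall x, I x -> C2_near K x /\ grad K x != 0),
      (* I bounds a convex body C *)
      [/\ convex C, compact C, interior C (0 : 'rV[R]_n.+1) &
          I = C `\` interior C] &
      (* positive definite second fundamental form (inward normal) *)
      (forall x, I x -> forall u : 'rV[R]_n.+1,
          u != 0 -> tangent K x u -> 0 < sff K x u u)].
Proof.
move=> K I C; split.
- exact: Kf_level_compact.
- move=> x /(Kf_level_neq0) x0.
  by split; [exact: C2_near_Kf|exact: grad_Kf_neq0].
- split; [exact: Kf_sublevel_convex|exact: Kf_sublevel_compact|
          |exact: Kf_level_boundary].
  by apply: Kf_lt1_interior => //; rewrite Kf0 ltr01.
- by move=> x /(Kf_level_neq0) x0 u u0 ut; exact: sff_Kf_gt0.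
Qed.
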